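(* Let $A,B\in\mathcal{M}_n^+$. Then, for $j=1,2,\dots,n$, $$s_j(A\nabla B-A\sharp B)\le\frac{1}{8}\,s_j\!\left((A\sharp B)^{-\frac12}(A-B)^2(A\sharp B)^{-\frac12}\right)$$ and $$s_j(A\nabla B-A\sharp B)\ge\frac{1}{8}\,s_j\!\left((A\nabla B)^{-\frac12}(A-B)^2(A\nabla B)^{-\frac12}\right).$$
   Context: $\mathcal{M}_n^+$ denotes the set of positive (definite) $n\times n$ complex matrices: $A\in\mathcal{M}_n^+$ iff $\langle Ax,x\rangle>0$ for all nonzero $x\in\mathbb{C}^n$. For $A,B\in\mathcal{M}_n^+$, the arithmetic mean is $A\nabla B=\frac{A+B}{2}$ and the geometric mean is $A\sharp B=A^{1/2}\left(A^{-1/2}BA^{-1/2}\right)^{1/2}A^{1/2}$. $s_j(X)$ denotes the $j$-th singular value of the $n\times n$ matrix $X$, the singular values being arranged in decreasing order and counted with multiplicity. *)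

(* Defs.v *)
From HB Require Import structures.
From mathcomp Require Import all_boot all_order all_algebra.
From mathcomp Require Import spectral sesquilinear reals.
From mathcomp Require Import complex.

Set Implicit Arguments.
Unset Strict Implicit.
Unset Printing Implicit Defensive.
Import Order.TTheory GRing.Theory Num.Theory.
Local Open Scope ring_scope.
Local Open Scope sesquilinear_scope.
Local Open Scope complex_scope.

Section MatrixMeans.
Variables (R : realType) (n : nat).
Implicit Types A B X : 'M[R[i]]_n.

(* In the order of R[i], 0 < z says that z is real and positive; the vectors
   are columns and <Ax, x> = x^* A x. *)
Definition posdefmx A : Prop :=
  forall x : 'cV[R[i]]_n, x != 0 -> 0 < (x ^t* *m A *m x) 0 0.

(* Spectral functional calculus. For A positive definite this is the positive
   square root A^(1/2); it is the junk value 0 when A is not normal. *)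
Definition mxsqrt A : 'M[R[i]]_n :=
  invmx (spectralmx A) *m diag_mx (map_mx sqrtC (spectral_diag A))
    *m spectralmx A.

(* A^(-1/2) *)
Definition mxisqrt A : 'M[R[i]]_n := invmx (mxsqrt A).

Definition amean A B : 'M[R[i]]_n := 2%:R^-1 *: (A + B).

Definition gmean A B : 'M[R[i]]_n :=
  mxsqrt A *m mxsqrt (mxisqrt A *m B *m mxisqrt A) *m mxsqrt A.

(* The square roots of the eigenvalues of X^* X with multiplicity, in decreasing
   order. These eigenvalues are real and nonnegative, so taking Re loses
   nothing. *)
Definition singvals X : seq R :=
  sort >=%R [seq Num.sqrt (complex.Re (spectral_diag (X ^t* *m X) 0 i))
            | i <- enum 'I_n].

(* Numbered from 0: [singval X j] is the (j+1)-st largest singular value. *)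
Definition singval X (j : 'I_n) : R := nth 0 (singvals X) j.

End MatrixMeans.

(* Main.v *)
(* Put P = A^(1/2) and S = (A^(-1/2) B A^(-1/2))^(1/2). Then A = P P and
   B = P S^2 P, so A - B = P (1 - S^2) P, the geometric mean is P S P, the
   arithmetic mean is P E P with E = (1 + S^2)/2, and their difference is
   1/2 P (1 - S)^2 P. As S and E commute,
     (A - B) (P S P)^-1 (A - B) - 4 P (1 - S)^2 P
       = P (1 - S)^2 S^-1 (1 - S)^2 P,
     4 P (1 - S)^2 P - (A - B) (P E P)^-1 (A - B)
       = P (1 - S)^2 E^-1 (1 - S)^2 P,
   and both right-hand sides are positive semidefinite. Weyl's monotonicity
   principle turns this into inequalities between singular values, and
   (A - B) G^-1 (A - B) has the singular values of G^(-1/2) (A - B)^2 G^(-1/2)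
   because X X^* and X^* X have the same characteristic polynomial. *)
Require Import Defs.
From mathcomp Require Import all_boot all_order all_algebra.
From mathcomp Require Import reals complex.
From mathcomp Require Import spectral sesquilinear ring.
Set Implicit Arguments.
Unset Strict Implicit.
Unset Printing Implicit Defensive.
Import Order.TTheory GRing.Theory Num.Theory.
Local Open Scope ring_scope.
Local Open Scope complex_scope.
Local Open Scope sesquilinear_scope.

(** * Characteristic polynomials, counting in sorted lists, kernels *)

(** Multiplying the block matrix [M] by two block triangular matrices gives
    [\det M = \det (T - b *m a)] and [\det M * \det T = \det (T - a *m b) * \det T]; then [\det T],
    a power of ['X], cancels. *)
Lemma char_poly_mulC (F : idomainType) n (A B : 'M[F]_n) :
  char_poly (A *m B) = char_poly (B *m A).
Proof.
rewrite /char_poly /char_poly_mx !map_mxM.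
set a := map_mx _ A; set b := map_mx _ B; set T : 'M[{poly F}]_n := 'X%:M.
pose M := block_mx 1%:M a b T.
have E1 : M *m block_mx 1%:M (- a) 0 1%:M = block_mx 1%:M 0 b (T - b *m a).
  rewrite mulmx_block !mulmx0 !mulmx1 !mul1mx !addr0 mulmxN addNr.
  by rewrite addrC.
have E2 : M *m block_mx T 0 (- b) 1%:M = block_mx (T - a *m b) a 0 T.
  rewrite mulmx_block !mulmx0 !mulmx1 !mul1mx !add0r !mulmxN.
  by rewrite scalar_mxC addrN.
have detT : \det T != 0 by rewrite det_scalar expf_neq0 // polyX_eq0.
apply: (mulIf detT); rewrite -(@det_ublock _ _ _ _ a) -E2 det_mulmx det_lblock.
rewrite det1 mulr1; congr (_ * _).
have := congr1 determinant E1.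
by rewrite det_mulmx det_ublock det_lblock !det1 !mulr1 mul1r.
Qed.

(** The entries above [t] form a prefix of a decreasing list. This turns inequalities between
    ordered eigenvalues into inequalities between cardinalities. *)
Lemma sorted_ge_lt_nth (R : realDomainType) (s : seq R) (t : R) (j : nat) :
  sorted >=%R s -> (j < size s)%N ->
  (t < nth 0 s j) = (j < count (> t) s)%N.
Proof.
elim: s j => // x s IHs j /= xs js.
have [tx|xt] := ltP t x.
  by case: j js => [|j] js //=; rewrite IHs ?(path_sorted xs).
(* The head is the largest entry and is at most [t], so both sides are false. *)
rewrite (_ : count _ s = 0%N).
  apply/negbTE; rewrite -leNgt; case: j js => [|j] //= js; apply: le_trans xt.
  exact: (allP (order_path_min ge_trans xs)) (mem_nth 0 js).
apply/eqP; rewrite -leqn0 leqNgt -has_count -all_predC.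
apply: sub_all (order_path_min ge_trans xs) => y /= yx.
by rewrite -leNgt (le_trans yx).
Qed.

Lemma nonzero_kernel (F : fieldType) (m n : nat) (Z : 'M[F]_(m, n)) :
  (m < n)%N -> exists2 v : 'cV_n, v != 0 & Z *m v = 0.
Proof.
move=> mn; have: kermx Z^T != 0.
  by rewrite kermx_eq0 /row_free mxrank_tr neq_ltn
             (leq_ltn_trans (rank_leq_row Z)).
case/rowV0Pn=> u /sub_kermxP uZ u0; exists u^T; first by rewrite trmx_eq0.
by apply: trmx_inj; rewrite trmx_mul trmxK uZ trmx0.
Qed.

(** * Spectral decomposition of normal matrices and quadratic forms *)

Section Spectrum.
Variable C : numClosedFieldType.

Lemma adjmxM m n p (A : 'M[C]_(m, n)) (B : 'M[C]_(n, p)) :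
  (A *m B)^t* = B^t* *m A^t*.
Proof. by rewrite trmx_mul map_mxM. Qed.

Lemma adjmxD m n (A B : 'M[C]_(m, n)) : (A + B)^t* = A^t* + B^t*.
Proof. by rewrite linearD map_mxD. Qed.

Lemma adjmx_hermitian n (A : 'M[C]_n) : A^t* = A -> A \is hermsymmx.
Proof. by move=> Ah; apply/is_hermitianmxP; rewrite expr0 scale1r. Qed.

Lemma adjmx_normal n (A : 'M[C]_n) : A^t* = A -> A \is normalmx.
Proof. by move=> /adjmx_hermitian/hermitian_normalmx. Qed.

(** The order of [spectral_diag] is not controlled, so eigenvalues are compared as multisets, read
    off the linear factors of the characteristic polynomial. *)
Lemma perm_spectral_diag n (A : 'M[C]_n) (d : 'rV[C]_n) :
  A \is normalmx -> char_poly A = char_poly (diag_mx d) ->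
  perm_eq [seq spectral_diag A 0 i | i <- enum 'I_n]
          [seq d 0 i | i <- enum 'I_n].
Proof.
have charE (e : 'rV[C]_n) : char_poly (diag_mx e) =
    \prod_(x <- [seq e 0 i | i <- enum 'I_n]) ('X - x%:P).
  rewrite char_poly_trig ?diag_mx_is_trig // big_map big_enum /=.
  by apply: eq_bigr => i _; rewrite mxE eqxx.
move=> /orthomx_spectralP {1}->.
rewrite -mulmxA char_poly_mulC mulmxK ?spectral_unit // !charE => E.
exact: prod_XsubC_eq.
Qed.

Lemma char_poly_spectral n (A : 'M[C]_n) :
  A \is normalmx -> char_poly A = char_poly (diag_mx (spectral_diag A)).
Proof.
move=> /orthomx_spectralP {1}->.
by rewrite -mulmxA char_poly_mulC mulmxK ?spectral_unit.
Qed.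

Lemma form_diag n (U : 'M[C]_n) (d : 'rV[C]_n) (x : 'cV[C]_n) :
  U \is unitarymx ->
  (x^t* *m (invmx U *m diag_mx d *m U) *m x) 0 0 =
  \sum_i d 0 i * `|(U *m x) i 0| ^+ 2.
Proof.
move=> Uu; rewrite invmx_unitary // !mulmxA -adjmxM -[_ *m U *m x]mulmxA.
rewrite mxE; apply: eq_bigr => i _.
by rewrite mul_mx_diag !mxE normCK [_ * d _ _]mulrC mulrA mulrAC -!mulrA.
Qed.

Lemma norm_unitary n (U : 'M[C]_n) (x : 'cV[C]_n) : U \is unitarymx ->
  \sum_i `|(U *m x) i 0| ^+ 2 = \sum_i `|x i 0| ^+ 2.
Proof.
move=> Uu; have := form_diag (const_mx 1) x Uu.
rewrite diag_const_mx mulmx1 mulVmx ?unitarymx_unit // mulmx1.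
under [X in _ = X]eq_bigr do rewrite mxE mul1r.
by move=> <-; rewrite mxE; apply: eq_bigr => i _; rewrite !mxE normCK mulrC.
Qed.

Lemma unitmx_mul_coord_neq0 n (U : 'M[C]_n) (x : 'cV[C]_n) :
  U \in unitmx -> x != 0 -> exists i, (U *m x) i 0 != 0.
Proof.
move=> Uu x0; apply/existsP; rewrite -negb_forall.
apply: contra x0 => /forallP Ux; apply/eqP.
rewrite -[x](mulKmx Uu) (_ : U *m x = 0) ?mulmx0 //.
by apply/matrixP => i j; rewrite ord1 [RHS]mxE; exact/eqP/Ux.
Qed.

(** Through this, sign conditions on the quadratic form pass to the eigenvalues. *)
Lemma form_spectral_eigenvector n (A : 'M[C]_n) i : A \is normalmx ->
  let x := invmx (spectralmx A) *m delta_mx i 0 in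
  x != 0 :> 'cV_n /\ (x^t* *m A *m x) 0 0 = spectral_diag A 0 i.
Proof.
move=> /orthomx_spectralP AE x; have Ux : spectralmx A *m x = delta_mx i 0.
  by rewrite mulKVmx ?spectral_unit.
split.
  apply/eqP => x0; move/matrixP/(_ i 0): Ux; rewrite x0 mulmx0 !mxE !eqxx.
  by move/eqP; rewrite eq_sym oner_eq0.
rewrite {1}AE form_diag ?spectral_unitarymx // Ux (bigD1 i) //= big1 => [|l li].
  by rewrite mxE !eqxx normr1 expr1n mulr1 addr0.
by rewrite mxE (negPf li) normr0 expr0n mulr0.
Qed.

(** The difference [N] is skew-Hermitian, hence normal, and its form vanishes because the form of
    [A^t*] is the conjugate of that of [A]. The eigenvalues of [N] are values of this form, so
    [N = 0]. *)
Lemma hermitian_of_real_form n (A : 'M[C]_n) :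
  (forall x : 'cV[C]_n, (x^t* *m A *m x) 0 0 \is Num.real) -> A^t* = A.
Proof.
move=> Areal; apply/esym/eqP; rewrite -subr_eq0; apply/eqP.
set N := A - A^t*.
have adjN : N^t* = - N by rewrite /N adjmxD linearN map_mxN trmxCK opprB addrC.
have Nn : N \is normalmx.
  by apply/normalmxP; rewrite adjN mulmxN mulNmx.
have N0 (x : 'cV[C]_n) : (x^t* *m N *m x) 0 0 = 0.
  rewrite /N mulmxBr mulmxBl mxE [X in _ + X]mxE; apply/eqP; rewrite subr_eq0.
  apply/eqP; rewrite -[LHS](CrealP (Areal x)).
  transitivity ((x^t* *m A *m x)^t* 0 0); first by rewrite !mxE.
  by rewrite !adjmxM trmxCK mulmxA.
have d0 : spectral_diag N = 0.
  apply/rowP => i; rewrite mxE.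
  by have [_ <-] := form_spectral_eigenvector i Nn; exact: N0.
by move/orthomx_spectralP: Nn ->; rewrite d0 linear0 mulmx0 mul0mx.
Qed.
End Spectrum.

(** * Positive matrices and Weyl's monotonicity principle *)

Section PositiveMatrices.
Variables (C : numClosedFieldType) (n : nat).
Implicit Types A B H K X : 'M[C]_n.

Definition psdmx A : Prop :=
  forall x : 'cV[C]_n, 0 <= (x^t* *m A *m x) 0 0.

Definition pdmx A : Prop :=
  forall x : 'cV[C]_n, x != 0 -> 0 < (x^t* *m A *m x) 0 0.

Lemma posdef_psd A : pdmx A -> psdmx A.
Proof.
move=> Apos x; have [->|x0] := eqVneq x 0; last exact/ltW/Apos.
by rewrite mulmx0 mxE.
Qed.

Lemma psd_hermitian A : psdmx A -> A^t* = A.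
Proof.
by move=> Apsd; apply: hermitian_of_real_form => x; exact: ger0_real.
Qed.

Lemma posdef_hermitian A : pdmx A -> A^t* = A.
Proof. by move=> /posdef_psd/psd_hermitian. Qed.

Lemma psd_spectral_diag A i : psdmx A -> 0 <= spectral_diag A 0 i.
Proof.
move=> Apsd; have /adjmx_normal := psd_hermitian Apsd.
by case/(form_spectral_eigenvector i) => _ <-.
Qed.

Lemma posdef_spectral_diag A i : pdmx A -> 0 < spectral_diag A 0 i.
Proof.
move=> Apos; have /adjmx_normal := posdef_hermitian Apos.
by case/(form_spectral_eigenvector i) => x0 <-; exact: Apos.
Qed.

Lemma posdef_unit A : pdmx A -> A \in unitmx.
Proof.
move=> Apos; rewrite -row_free_unit -kermx_eq0 -[_ == 0]negbK; apply/negP.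
case/rowV0Pn => u /sub_kermxP uA u0.
suff /Apos : u^t* != 0 by rewrite trmxCK uA mul0mx mxE ltxx.
by apply: contra u0 => /eqP u0; rewrite -[u]trmxCK u0 trmx0 map_mx0.
Qed.

Lemma posdef_congr A P : P \in unitmx -> pdmx A ->
  pdmx (P^t* *m A *m P).
Proof.
move=> Pu Apos x x0; rewrite !mulmxA -adjmxM -[_ *m P *m x]mulmxA; apply: Apos.
by apply: contra x0 => /eqP Px; rewrite -(mulKmx Pu x) Px mulmx0.
Qed.

Lemma psd_congr A P : psdmx A -> psdmx (P^t* *m A *m P).
Proof. by move=> Apsd x; rewrite !mulmxA -adjmxM -[_ *m P *m x]mulmxA. Qed.

Lemma posdef_inv A : pdmx A -> pdmx (invmx A).
Proof.
move=> Apos; have Au := posdef_unit Apos.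
have -> : invmx A = (invmx A)^t* *m A *m invmx A.
  rewrite -mulmxA mulmxV // mulmx1 trmx_inv map_invmx.
  by rewrite (posdef_hermitian Apos).
by apply: posdef_congr; rewrite ?unitmx_inv.
Qed.

Lemma posdefD A B : pdmx A -> pdmx B -> pdmx (A + B).
Proof.
move=> Apos Bpos x x0; rewrite mulmxDr mulmxDl mxE.
by rewrite addr_gt0 ?Apos ?Bpos.
Qed.

Lemma posdefZ (a : C) A : 0 < a -> pdmx A -> pdmx (a *: A).
Proof.
by move=> a0 Apos x x0; rewrite -scalemxAr -scalemxAl mxE mulr_gt0 ?Apos.
Qed.

Lemma psdZ (a : C) A : 0 <= a -> psdmx A -> psdmx (a *: A).
Proof.
by move=> a0 Apsd x; rewrite -scalemxAr -scalemxAl mxE mulr_ge0 ?Apsd.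
Qed.

Lemma posdef1 : pdmx (1%:M : 'M[C]_n).
Proof.
move=> x x0; have [i xi] : exists i, x i 0 != 0.
  by rewrite -[x]mul1mx; exact: unitmx_mul_coord_neq0 (unitmx1 _ _) x0.
rewrite mulmx1 mxE (bigD1 i) //= ltr_pwDl //.
  by rewrite !mxE mulrC mul_conjC_gt0.
by apply: sumr_ge0 => l _; rewrite !mxE mulrC mul_conjC_ge0.
Qed.

Lemma psd_gram X : psdmx (X^t* *m X).
Proof.
move=> x; rewrite mulmxA -adjmxM -mulmxA mxE; apply: sumr_ge0 => i _.
by rewrite !mxE mulrC mul_conjC_ge0.
Qed.

Lemma spectral_diag_real A i :
  A^t* = A -> spectral_diag A 0 i \is Num.real.
Proof.
by move=> /adjmx_hermitian/hermitian_spectral_diag_real/mxOverP/(_ 0 i).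
Qed.

(* Weyl's monotonicity principle: if [H] had more eigenvalues above [c * t] than
   [K] has above [t], some nonzero vector would lie in the span of the former
   eigenvectors and be orthogonal to the latter. *)
Lemma card_spectral_diag_le H K (c t : C) :
  H^t* = H -> K^t* = K -> 0 <= c -> t \is Num.real -> psdmx (c *: K - H) ->
  (#|[set i | (c * t < spectral_diag H 0 i)%R]| <=
   #|[set i | (t < spectral_diag K 0 i)%R]|)%N.
Proof.
move=> Hh Kh c0 treal HK; rewrite leqNgt; apply/negP.
set b := [set i | _]; set a := [set i | _] => ba.
pose UH := spectralmx H; pose UK := spectralmx K.
pose ZH := rowsub (enum_val : 'I_#|~: a| -> 'I_n) UH.
pose ZK := rowsub (enum_val : 'I_#|b| -> 'I_n) UK.
(* By [ba], the stacked matrix has [#|~: a| + #|b| < n] rows. *)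
have [|v v0] := @nonzero_kernel _ _ _ (col_mx ZH ZK).
  by rewrite -[X in (_ < X)%N](card_ord n) -(cardsC a) addnC ltn_add2r.
rewrite mul_col_mx => /eqP; rewrite col_mx_eq0 => /andP[/eqP vH /eqP vK].
have vHa i : i \notin a -> (UH *m v) i 0 = 0.
  rewrite -in_setC => ia.
  move/matrixP/(_ (enum_rank_in ia i) 0): vH.
  by rewrite mul_rowsub_mx !mxE enum_rankK_in // => ->.
have vKb i : i \in b -> (UK *m v) i 0 = 0.
  move=> ib; move/matrixP/(_ (enum_rank_in ib i) 0): vK.
  by rewrite mul_rowsub_mx !mxE enum_rankK_in // => ->.
have := HK v; rewrite mulmxBr mulmxBl -scalemxAr -scalemxAl mxE.
rewrite [in X in X + _]mxE [in X in _ + X]mxE subr_ge0.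
move: (adjmx_normal Hh) (adjmx_normal Kh).
move=> /orthomx_spectralP {1}-> /orthomx_spectralP {1}->.
rewrite !form_diag ?spectral_unitarymx // -/UH -/UK.
apply/negP/negbT/lt_geF.
have [i vi] := unitmx_mul_coord_neq0 (spectral_unit H) v0.
(* The value [c * t] times the squared norm of [v] separates the two forms: only eigenvalues of [K]
   at most [t] contribute, and only eigenvalues of [H] above [c * t], at least one of them with
   nonzero weight. *)
apply: (@le_lt_trans _ _ (c * t * \sum_i `|(UH *m v) i 0| ^+ 2)).
  rewrite norm_unitary ?spectral_unitarymx // -(@norm_unitary _ _ UK)
          ?spectral_unitarymx //.
  rewrite -mulrA ler_wpM2l // mulr_sumr; apply: ler_sum => l _.
  have [lb|] := boolP (l \in b); first by rewrite vKb // normr0 expr0n !mulr0.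
  rewrite inE -real_leNgt ?spectral_diag_real // => lk.
  by rewrite ler_wpM2r ?exprn_ge0.
have ai : i \in a by apply: contraNT vi => /vHa ->.
rewrite mulr_sumr (bigD1 i) //= [ltRHS](bigD1 i) //= ltr_leD //.
  by rewrite inE in ai; rewrite ltr_pM2r ?exprn_gt0 ?normr_gt0.
apply: ler_sum => l _; have [la|la] := boolP (l \in a); last first.
  by rewrite vHa // normr0 expr0n !mulr0.
by rewrite ler_wpM2r ?exprn_ge0 // ltW //; rewrite inE in la.
Qed.

(** * Square roots and Gram matrices *)

Definition sqrtmx A : 'M[C]_n :=
  invmx (spectralmx A) *m diag_mx (map_mx sqrtC (spectral_diag A))
    *m spectralmx A.

Lemma posdef_sqrt A : pdmx A -> pdmx (sqrtmx A).
Proof.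
move=> Apos x x0; rewrite form_diag ?spectral_unitarymx //.
have [i vi] := unitmx_mul_coord_neq0 (spectral_unit A) x0.
rewrite (bigD1 i) //= ltr_pwDl //.
  rewrite mulr_gt0 ?exprn_gt0 ?normr_gt0 // mxE sqrtC_gt0.
  exact: posdef_spectral_diag.
apply: sumr_ge0 => l _; rewrite mulr_ge0 ?exprn_ge0 // mxE sqrtC_ge0.
exact/ltW/posdef_spectral_diag.
Qed.

Lemma sqrtmxK A : pdmx A -> sqrtmx A *m sqrtmx A = A.
Proof.
move=> /posdef_hermitian/adjmx_normal/orthomx_spectralP {3}->.
rewrite /sqrtmx !mulmxA mulmxK ?spectral_unit //.
rewrite -[_ *m diag_mx _ *m diag_mx _]mulmxA.
rewrite mulmx_diag; congr (_ *m diag_mx _ *m _).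
by apply/matrixP => i j; rewrite ord1 !mxE -expr2 sqrtCK.
Qed.

Lemma isqrtmx_hermitian A : pdmx A -> (invmx (sqrtmx A))^t* = invmx (sqrtmx A).
Proof. by move=> /posdef_sqrt/posdef_inv/posdef_hermitian. Qed.

Lemma isqrtmxK A : pdmx A -> invmx (sqrtmx A) *m invmx (sqrtmx A) = invmx A.
Proof.
move=> Apos; have Su := posdef_unit (posdef_sqrt Apos).
rewrite -[LHS](mulKmx (posdef_unit Apos)) -{2}(sqrtmxK Apos).
by rewrite -mulmxA mulKVmx // mulmxV // mulmx1.
Qed.

Lemma perm_spectral_diag_sqr H : H^t* = H ->
  perm_eq [seq spectral_diag (H^t* *m H) 0 i | i <- enum 'I_n]
          [seq (spectral_diag H 0 i) ^+ 2 | i <- enum 'I_n].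
Proof.
move=> Hh; pose d := \row_i (spectral_diag H 0 i) ^+ 2.
rewrite [X in perm_eq _ X](@eq_map _ _ _ (d 0)) => [|i]; last by rewrite mxE.
apply: perm_spectral_diag.
  by apply: adjmx_normal; rewrite adjmxM trmxCK.
have /orthomx_spectralP HE := adjmx_normal Hh.
rewrite Hh {1 2}HE !mulmxA mulmxK ?spectral_unit // -mulmxA -mulmxA.
rewrite char_poly_mulC -!mulmxA mulmxV ?spectral_unit // mulmx1 mulmx_diag.
by congr (char_poly (diag_mx _)); apply/rowP => i; rewrite !mxE expr2.
Qed.

Lemma psd_gramC X : psdmx (X *m X^t*).
Proof. by rewrite -{1}[X]trmxCK; exact: psd_gram. Qed.

Lemma perm_spectral_diag_gramC X :
  perm_eq [seq spectral_diag (X^t* *m X) 0 i | i <- enum 'I_n]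
          [seq spectral_diag (X *m X^t*) 0 i | i <- enum 'I_n].
Proof.
apply: perm_spectral_diag; first exact/adjmx_normal/psd_hermitian/psd_gram.
rewrite char_poly_mulC.
exact/char_poly_spectral/adjmx_normal/psd_hermitian/psd_gramC.
Qed.

Lemma posdef_sub_hermitian A B : pdmx A -> pdmx B -> (A - B)^t* = A - B.
Proof.
by move=> Apos Bpos; rewrite adjmxD linearN map_mxN !posdef_hermitian.
Qed.

Lemma psd_hermitian_congr_inv G D : pdmx G -> D^t* = D ->
  psdmx (D *m invmx G *m D).
Proof.
by move=> Gpos Dh; rewrite -{1}Dh; exact/psd_congr/posdef_psd/posdef_inv.
Qed.

(** The factor [X] links the matrix whose singular values are wanted, [X^t* *m X], to [X *m X^t*],
    which can be compared with the gap between the means in the semidefinite order. *)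
Lemma gram_isqrtmx (G D : 'M[C]_n) : pdmx G -> D^t* = D ->
  let X := D *m invmx (sqrtmx G) in
  X^t* *m X = invmx (sqrtmx G) *m D ^+ 2 *m invmx (sqrtmx G) /\
  X *m X^t* = D *m invmx G *m D.
Proof.
move=> Gpos Dh X; rewrite adjmxM Dh isqrtmx_hermitian // -(isqrtmxK Gpos).
by rewrite /X expr2 -[D * D]/(D *m D) !mulmxA.
Qed.
End PositiveMatrices.

(** * Polynomial calculus in [S] for the gap between the means *)

Section MeanGap.
Variables (C : numClosedFieldType) (n : nat).
Variables P S : 'M[C]_n.+1.
Hypotheses (Ppos : pdmx P) (Spos : pdmx S).

(** Writing expressions in [S] as images of polynomials makes them commute and leaves the identities
    to [ring] in [{poly C}]. *)
Local Notation phi := (horner_mx S).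
Local Notation cong p := (P * phi p * P).

Let Pu : P \in unitmx := posdef_unit Ppos.
Let Ph : P^t* = P := posdef_hermitian Ppos.

Lemma phi_sub1_hermitian : (phi (1 - 'X))^t* = phi (1 - 'X).
Proof.
rewrite rmorphB rmorph1 /= horner_mx_X adjmxD linearN map_mxN.
by rewrite trmx1 map_mx1 posdef_hermitian.
Qed.

Lemma phi_sub1X_hermitian r : (phi ((1 - 'X) ^+ r))^t* = phi ((1 - 'X) ^+ r).
Proof.
elim: r => [|r IHr]; first by rewrite rmorph1 trmx1 map_mx1.
rewrite {1}exprSr rmorphM /= -mulmxE adjmxM IHr phi_sub1_hermitian.
by rewrite mulmxE -rmorphM -exprS.
Qed.

(** A congruence of [V] by [phi ((1 - 'X) ^+ r) * P]. The gap uses [r = 1], the two remainders use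
    [r = 2]. *)
Lemma psd_sandwich V r : psdmx V ->
  psdmx (P * phi ((1 - 'X) ^+ r) * V * phi ((1 - 'X) ^+ r) * P).
Proof.
move=> Vpsd; have := psd_congr (phi ((1 - 'X) ^+ r) * P) Vpsd.
by rewrite -mulmxE adjmxM phi_sub1X_hermitian Ph !mulmxA.
Qed.

Section Denominator.
Variable e : {poly C}.
Hypothesis epos : pdmx (phi e).

Let eu : phi e \in unitmx := posdef_unit epos.

Lemma phi_invC p : invmx (phi e) * phi p = phi p * invmx (phi e).
Proof.
rewrite -mulmxE -[LHS]mulmx1 -(mulmxV eu) !mulmxA; congr (_ *m _).
rewrite -[_ *m phi p *m _]mulmxA mulmxE -rmorphM mulrC rmorphM -mulmxE.
by rewrite mulmxA mulVmx // mul1mx.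
Qed.

Lemma phi_mul_inv p q :
  phi p * invmx (phi e) * phi q = phi (p * q) * invmx (phi e).
Proof. by rewrite -mulrA phi_invC mulrA -rmorphM. Qed.

(** The inner factors [P] cancel and [invmx (phi e)] commutes with [phi p]. For [p = 1 - 'X ^+ 2]
    the outer factors are [A - B], and [e] stands for either mean. *)
Lemma sandwich_gram p :
  P * phi p * P * invmx (P * phi e * P) * (P * phi p * P) =
  P * (phi (p ^+ 2) * invmx (phi e)) * P.
Proof.
have -> : invmx (P * phi e * P) = invmx P * invmx (phi e) * invmx P.
  apply: (mulrI (_ : P * phi e * P \is a GRing.unit)).
    by rewrite -!mulmxE; apply: (_ : _ \in unitmx); rewrite !unitmx_mul Pu eu.
  rewrite -!mulmxE mulmxV ?unitmx_mul ?Pu ?eu //.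
  by rewrite !mulmxA mulmxK // -!mulmxA mulKVmx // mulmxV.
rewrite expr2 -phi_mul_inv -!mulmxE !mulmxA mulmxK //.
by rewrite -!mulmxA mulKmx.
Qed.

Lemma phi_eq_mul_inv q : phi q = phi (q * e) * invmx (phi e).
Proof. by rewrite rmorphM -!mulmxE mulmxK. Qed.
End Denominator.

Lemma psd_sub_geometric :
  psdmx (cong (1 - 'X ^+ 2) * invmx (cong 'X) * cong (1 - 'X ^+ 2)
         - cong (4 * (1 - 'X) ^+ 2)).
Proof.
have epos : pdmx (phi 'X) by rewrite horner_mx_X.
rewrite sandwich_gram // (phi_eq_mul_inv epos (4 * _)).
rewrite -mulrBl -mulrBr -mulrBl -rmorphB /=.
(* Over the denominator ['X] the numerator is [(1 - 'X) ^+ 2 * ((1 + 'X) ^+ 2 - 4 * 'X)]. *)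
rewrite (_ : _ - _ = (1 - 'X) ^+ 2 * (1 - 'X) ^+ 2); last by ring.
rewrite -phi_mul_inv // !mulrA.
exact/psd_sandwich/posdef_psd/posdef_inv.
Qed.

Lemma posdef_horner_arithmetic (h : C) : 0 < h ->
  pdmx (phi (h%:P * (1 + 'X ^+ 2))).
Proof.
move=> h0; rewrite mul_polyC linearZ /= rmorphD rmorph1 rmorphXn /= horner_mx_X.
apply: posdefZ => //; apply: posdefD; first exact: posdef1.
rewrite expr2 -mulmxE -{1}(posdef_hermitian Spos) -[S^t*]mulmx1.
by apply: posdef_congr; [exact: posdef_unit | exact: posdef1].
Qed.

Lemma horner_sub_means (h : C) : 2 * h = 1 ->
  cong (h%:P * (1 + 'X ^+ 2)) - cong 'X = 8^-1 *: cong (4 * (1 - 'X) ^+ 2).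
Proof.
move=> h2; rewrite -mulrBl -mulrBr -rmorphB /=.
rewrite scalerAl scalerAr -linearZ /=; congr (_ * phi _ * _).
have hE : h = 2^-1.
  have two0 : 2 != 0 :> C by rewrite pnatr_eq0.
  by rewrite -[LHS](mulKf two0) h2 mulr1.
have -> : 8^-1 = h * h * h :> C by rewrite hE; field.
have hP : h%:P + h%:P = 1 :> {poly C} by rewrite -polyCD -mulr2n -mulr_natl h2.
rewrite -mul_polyC !polyCM.
(* Inserting factors [h%:P + h%:P = 1] splits the claim into identities that hold with [h] as an
   indeterminate. *)
transitivity (h%:P * (1 + 'X ^+ 2) - 'X * (h%:P + h%:P) : {poly C}).
  by rewrite hP mulr1.
transitivity ((h%:P + h%:P) * (h%:P + h%:P) * h%:P * (1 - 'X) ^+ 2 : {poly C}).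
  by rewrite [in RHS]hP; ring.
by ring.
Qed.

Lemma psd_horner_gap : psdmx (cong (4 * (1 - 'X) ^+ 2)).
Proof.
rewrite mulr_natl -scaler_nat linearZ /= -scalerAr -scalerAl.
apply: psdZ; first by rewrite ler0n.
rewrite expr2 rmorphM /= mulrA -[P * _]mulr1 -{2}[1 - 'X]expr1 -[1 - 'X]expr1.
exact/psd_sandwich/posdef_psd/posdef1.
Qed.

Lemma psd_sub_arithmetic (h : C) : 2 * h = 1 ->
  psdmx (cong (4 * (1 - 'X) ^+ 2)
    - cong (1 - 'X ^+ 2) * invmx (cong (h%:P * (1 + 'X ^+ 2)))
      * cong (1 - 'X ^+ 2)).
Proof.
move=> h2; have h0 : 0 < h.
  by rewrite -(@pmulr_rgt0 _ 2) ?ltr0n // h2 ltr01.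
have epos := posdef_horner_arithmetic h0.
have hP : h%:P + h%:P = 1 :> {poly C}.
  by rewrite -polyCD -mulr2n -mulr_natl h2.
rewrite sandwich_gram // (phi_eq_mul_inv epos (4 * _)).
rewrite -mulrBl -mulrBr -mulrBl -rmorphB /=.
(* Since [4 * h = 2], the numerator is [(1 - 'X) ^+ 2 * (2 * (1 + 'X ^+ 2) - (1 + 'X) ^+ 2)]. *)
rewrite (_ : _ - _ = (1 - 'X) ^+ 2 * (1 - 'X) ^+ 2); last first.
  transitivity (2 * (1 - 'X) ^+ 2 * (1 + 'X ^+ 2) * (h%:P + h%:P)
                - (1 - 'X ^+ 2) ^+ 2 : {poly C}); first by ring.
  by rewrite hP; ring.
rewrite -phi_mul_inv // !mulrA.
exact/psd_sandwich/posdef_psd/posdef_inv.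
Qed.
End MeanGap.

(** The last two bounds have the shape [c *: K - H] of Weyl's principle, with [c = 8^-1] and
    [c = 8]; positivity of [M - G] makes its singular values eigenvalues. *)
Lemma mean_gap_bounds (C : numClosedFieldType) (n : nat) (A B : 'M[C]_n)
    (P := sqrtmx A) (S := sqrtmx (invmx P *m B *m invmx P))
    (G := P *m S *m P) (M := 2^-1 *: (A + B)) :
  pdmx A -> pdmx B ->
  [/\ pdmx G, pdmx M, psdmx (M - G),
      psdmx (8^-1 *: ((A - B) *m invmx G *m (A - B)) - (M - G)) &
      psdmx (8 *: (M - G) - (A - B) *m invmx M *m (A - B))].
Proof.
case: n A B @P @S @G @M => [|n] A B P S G M Apos Bpos.
  (* In dimension 0 the only vector is zero; the polynomial calculus covers [n.+1]. *)
  by split=> x; rewrite [x]flatmx0 ?eqxx // mulmx0 mxE.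
have Ppos : pdmx P := posdef_sqrt Apos; have Pu := posdef_unit Ppos.
have Kpos : pdmx (invmx P *m B *m invmx P).
  by rewrite -{1}isqrtmx_hermitian //; apply: posdef_congr; rewrite ?unitmx_inv.
have Spos : pdmx S := posdef_sqrt Kpos.
have AE : A = P * P by rewrite -mulmxE sqrtmxK.
have SE : S *m S = invmx P *m B *m invmx P := sqrtmxK Kpos.
(* From here on, [P] and [S] enter only through positivity and their squares. *)
clearbody S P.
have BE : B = P * S ^+ 2 * P.
  by rewrite expr2 -!mulmxE SE !mulmxA mulmxV // mul1mx mulmxKV.
have Mpos : pdmx M.
  by apply: posdefZ; [rewrite invr_gt0 ltr0n | exact: posdefD].
have Gpos : pdmx G.
  by rewrite /G -{1}(posdef_hermitian Ppos); exact: posdef_congr.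
pose cong p := P * horner_mx S p * P.
have subE : A - B = cong (1 - 'X ^+ 2).
  rewrite /cong rmorphB rmorph1 rmorphXn /= horner_mx_X.
  by rewrite mulrBr mulrBl mulr1 -AE -BE.
pose h : C := 2^-1; have h2 : 2 * h = 1 by rewrite mulfV ?pnatr_eq0.
have ME : M = cong (h%:P * (1 + 'X ^+ 2)).
  rewrite /cong mul_polyC linearZ /= rmorphD rmorph1 rmorphXn /= horner_mx_X.
  by rewrite -scalerAr -scalerAl mulrDr mulrDl mulr1 -AE -BE.
have GE : G = cong 'X by rewrite /cong horner_mx_X.
have gapE : M - G = 8^-1 *: cong (4 * (1 - 'X) ^+ 2).
  by rewrite ME GE; exact: horner_sub_means.
split=> //.
- rewrite gapE; apply: psdZ; first by rewrite invr_ge0 ler0n.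
  exact: psd_horner_gap.
- rewrite gapE -scalerBr; apply: psdZ; first by rewrite invr_ge0 ler0n.
  by rewrite subE GE; exact: psd_sub_geometric.
rewrite gapE scalerA mulfV ?pnatr_eq0 // scale1r subE ME.
exact: psd_sub_arithmetic.
Qed.

(** * From semidefinite bounds to singular values *)

(* At [C := R[i]], [pdmx] and [sqrtmx] are convertible to [posdefmx] and
   [mxsqrt], so the results above apply to those without restatement. *)
Section SingularValues.
Variables (R : realType) (n : nat).
Implicit Types A B G D H K X : 'M[R[i]]_n.

(** Meant for Hermitian [H], where taking real parts loses nothing. *)
Definition eigvals H : seq R :=
  sort >=%R [seq complex.Re (spectral_diag H 0 i) | i <- enum 'I_n].

Lemma size_eigvals H : size (eigvals H) = n.
Proof. by rewrite size_sort size_map size_enum_ord. Qed.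

Lemma lt_nth_eigvals H (t : R) (j : 'I_n) : H^t* = H ->
  (t < nth 0 (eigvals H) j) =
  (j < #|[set i | (t%:C < spectral_diag H 0 i)%R]|)%N.
Proof.
move=> Hh; rewrite sorted_ge_lt_nth ?size_eigvals //; last first.
  exact/sort_sorted/ge_total.
rewrite count_sort count_map cardsE cardE size_filter -enumT.
congr (_ < _)%N; apply: eq_count => i.
transitivity (t%:C < spectral_diag H 0 i); last by [].
by rewrite -[in RHS](RRe_real (spectral_diag_real i Hh)) ltcR.
Qed.

Lemma eigvals_le H K (c : R) (j : 'I_n) : H^t* = H -> K^t* = K -> 0 <= c ->
  psdmx (c%:C *: K - H) ->
  nth 0 (eigvals H) j <= c * nth 0 (eigvals K) j.
Proof.
move=> Hh Kh c0 HK; rewrite leNgt lt_nth_eigvals //.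
(* Weyl's principle is applied at the threshold [k]: as [j] counts from 0, at most [j] eigenvalues
   of [K] exceed [k], hence at most [j] of [H] exceed [c * k]. *)
set k := nth 0 (eigvals K) j; rewrite rmorphM /= -leqNgt.
have kreal : k%:C \is Num.real by rewrite complex_real.
apply: (leq_trans (card_spectral_diag_le Hh Kh _ kreal HK)).
  by rewrite ler0c.
by rewrite leqNgt -lt_nth_eigvals // ltxx.
Qed.

(** The eigenvalues of [H^t* *m H] are the squares of those of [H], and the square root undoes the
    squaring because the latter are nonnegative. *)
Lemma singvals_psd H : psdmx H -> singvals H = eigvals H.
Proof.
move=> Hpsd; have Hh := psd_hermitian Hpsd.
pose f (z : R[i]) := Num.sqrt (complex.Re z).
move/(perm_map f): (perm_spectral_diag_sqr Hh).
rewrite -(map_comp f _ (enum _)) -(map_comp f _ (enum _)).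
rewrite [X in perm_eq _ X](@eq_map _ _ _
  (fun i => complex.Re (spectral_diag H 0 i))).
  by move/(perm_sortP ge_total ge_trans ge_anti).
move=> i; rewrite /f /= -(RRe_real (spectral_diag_real i Hh)).
rewrite -rmorphXn /= sqrtr_sqr ger0_norm // -ler0c.
by rewrite (RRe_real (spectral_diag_real i Hh)) psd_spectral_diag.
Qed.

Lemma singvals_gramC X : singvals (X^t* *m X) = singvals (X *m X^t*).
Proof.
rewrite (singvals_psd (psd_gram X)) (singvals_psd (psd_gramC X)).
apply/(perm_sortP ge_total ge_trans ge_anti).
rewrite (map_comp (@complex.Re R)) [X in perm_eq _ X](map_comp (@complex.Re R)).
exact/perm_map/perm_spectral_diag_gramC.
Qed.

Lemma singval_le H K (c : R) (j : 'I_n) : psdmx H -> 0 <= c -> psdmx K ->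
  psdmx (c%:C *: K - H) -> singval H j <= c * singval K j.
Proof.
move=> Hpsd c0 Kpsd HK; rewrite /singval.
rewrite (singvals_psd Hpsd) (singvals_psd Kpsd).
exact: eigvals_le (psd_hermitian Hpsd) (psd_hermitian Kpsd) c0 HK.
Qed.

Lemma singval_mxisqrt_sandwich G D j : pdmx G -> D^t* = D ->
  singval (mxisqrt G *m D ^+ 2 *m mxisqrt G) j = singval (D *m invmx G *m D) j.
Proof.
move=> Gpos Dh; have [XX XX'] := gram_isqrtmx Gpos Dh.
have := singvals_gramC (D *m invmx (sqrtmx G)); rewrite XX XX'.
by rewrite /singval => <-.
Qed.
End SingularValues.

Theorem corollary2p1 (R : realType) (n : nat) (A B : 'M[R[i]]_n)
    (hA : posdefmx A) (hB : posdefmx B) (j : 'I_n) :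
  singval (amean A B - gmean A B) j
    <= 8%:R^-1 * singval (mxisqrt (gmean A B) *m (A - B) ^+ 2
                            *m mxisqrt (gmean A B)) j
  /\ 8%:R^-1 * singval (mxisqrt (amean A B) *m (A - B) ^+ 2
                            *m mxisqrt (amean A B)) j
    <= singval (amean A B - gmean A B) j.
Proof.
have [Gpos Mpos gap_psd upper lower] := mean_gap_bounds hA hB.
have Dh := posdef_sub_hermitian hA hB.
have c8 : (8%:R^-1 : R)%:C = 8^-1 :> R[i] by rewrite fmorphV rmorph_nat.
rewrite (singval_mxisqrt_sandwich j Gpos Dh).
rewrite (singval_mxisqrt_sandwich j Mpos Dh).
split.
  apply: singval_le gap_psd _ (psd_hermitian_congr_inv Gpos Dh) _.
    by rewrite invr_ge0 ler0n.
  by rewrite c8; exact: upper.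
(* Moving the factor to the other side gives the constant 8 of [lower]. *)
rewrite ler_pdivrMl ?ltr0n //.
apply: singval_le (psd_hermitian_congr_inv Mpos Dh) _ gap_psd _.
  by rewrite ler0n.
by rewrite rmorph_nat; exact: lower.
Qed.
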